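(* Let $P$ denote a (real-valued, random) functional of the solution of an SPDE for a given Brownian path $M_t$, and for $l=0,1,2,\dots$ let $\widehat{P}_l$ denote the corresponding level $l$ numerical approximation. Suppose there exist independent estimators $\widehat{Y}_l$ based on $N_l$ Monte Carlo samples, and positive constants $\alpha,\beta,\gamma,c_1,c_2,c_3$ such that $\alpha\ge\frac12\gamma$ and (i) $\left|\mathbb{E}[\widehat{P}_l-P]\right|\le c_1 2^{-\alpha l}$; (ii) $\mathbb{E}[\widehat{Y}_0]=\mathbb{E}[\widehat{P}_0]$, and $\mathbb{E}[\widehat{Y}_l]=\mathbb{E}[\widehat{P}_l-\widehat{P}_{l-1}]$ for $l>0$; (iii) $\mathbb{V}[\widehat{Y}_l]\le c_2 N_l^{-1}2^{-\beta l}$; (iv) $C_l\le c_3 N_l 2^{\gamma l}$, where $C_l$ is the computational complexity of $\widehat{Y}_l$. Then there exists a positive constant $c_4$ such that for any $0<\varepsilon<e^{-1}$ there are values $L$ and $N_l$ ($0\le l\le L$) for which the multilevel estimator $$\widehat{Y}=\sum_{l=0}^L\widehat{Y}_l$$ has mean-square error $$\mathbb{E}\left[\left(\widehat{Y}-\mathbb{E}[P]\right)^2\right]<\varepsilon^2$$ with a computational complexity $C$ bounded by $$C\le\begin{cases} c_4\,\varepsilon^{-2}, & \beta>\gamma,\\ c_4\,\varepsilon^{-2}(\log\varepsilon)^2, & \beta=\gamma,\\ c_4\,\varepsilon^{-2-(\gamma-\beta)/\alpha}, & 0<\beta<\gamma.\end{cases}$$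
   Context: $\mathbb{V}$ denotes variance. The random variables $P$ and $\widehat{P}_l$ are integrable. For each level $l\ge0$, the number of samples $N_l$ may be chosen as any positive integer, and hypotheses (ii)–(iv) are understood to hold for every such choice (with the constants independent of $l$ and $N_l$); for any choice of $N_0,\dots,N_L$ the estimators $\widehat{Y}_0,\dots,\widehat{Y}_L$ are mutually independent. The computational complexity of the multilevel estimator is $C=\sum_{l=0}^L C_l$. *)

(* Defs.v *)
From HB Require Import structures.
From mathcomp Require Import all_boot all_order all_algebra finmap.
From mathcomp Require Import all_classical all_reals all_analysis.

Set Implicit Arguments.
Unset Strict Implicit.
Unset Printing Implicit Defensive.

Import Order.TTheory GRing.Theory Num.Theory.
Import numFieldNormedType.Exports.

Local Open Scope classical_set_scope.
Local Open Scope ring_scope.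

(* Mutual independence of a family of real random variables: the product rule
   for every finite subfamily and all Borel sets. *)
Definition mutually_independent (d : measure_display) (Omega : measurableType d)
    (R : realType) (mu : probability Omega R) (I : choiceType)
    (X : I -> {RV mu >-> R}) : Prop :=
  forall (J : {fset I}) (B : I -> set R),
    (forall i, i \in J -> measurable (B i)) ->
    mu (\bigcap_(i in [set` J]) (X i @^-1` B i)) =
    (\prod_(i <- J) mu (X i @^-1` B i))%E.

(* [Y l n] is the level-l estimator based on n samples, [N l] the number of
   samples used at level l. *)
Definition multilevel_estimator (d : measure_display) (Omega : measurableType d)
    (R : realType) (mu : probability Omega R)
    (Y : nat -> nat -> {RV mu >-> R}) (L : nat) (N : nat -> nat) : Omega -> R :=
  fun w => \sum_(l < L.+1) Y l (N l) w.

(* [C l n] is the cost of the level-l estimator based on n samples. *)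
Definition multilevel_complexity (R : realType) (C : nat -> nat -> R)
    (L : nat) (N : nat -> nat) : R :=
  \sum_(l < L.+1) C l (N l).

(* Main.v *)
(* Independence kills the cross terms, so the mean-square error is the sum of the
   level variances plus the squared bias, and by telescoping the bias is that of
   the finest level L.  Take L minimal with c1 2^(-alpha L) <= eps/2, so that
   2^(alpha L) = O(1/eps), and N_l proportional to 2^(-(beta+gamma)l/2), scaled so
   that the variances add up to at most eps^2/2.  With
   S = sum_(l <= L) 2^((gamma-beta)l/2) the cost is then O(eps^-2 S^2) in all
   regimes: rounding N_l up costs O(2^(gamma L)), which is O(eps^-2) because
   gamma <= 2 alpha.  The three regimes only differ in the growth of the geometric
   sum S. *)
Require Import Defs.
From HB Require Import structures.
From mathcomp Require Import all_boot all_order all_algebra finmap.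
From mathcomp Require Import all_classical all_reals all_analysis.
From mathcomp Require Import measurable_realfun ring lra.

Import Order.TTheory GRing.Theory Num.Theory.
Import numFieldNormedType.Exports.

Local Open Scope classical_set_scope.
Local Open Scope ring_scope.

(** * Square integrability, covariance and variance of sums *)

Section second_moments.
Set Implicit Arguments.
Unset Strict Implicit.
Local Open Scope ereal_scope.
Context d (T : measurableType d) (R : realType) (mu : probability T R).

(* Integrability of [X] is not needed: if its mean is infinite, the variance is
   taken about [fine 'E_mu[X] = 0]. *)
Lemma Lfun2_variance_lty (X : {RV mu >-> R}) :
  'V_mu[X] < +oo -> (X : T -> R) \in Lfun mu 2%:E.
Proof.
move=> VX; set m := fine 'E_mu[X].
have Z2 : (X \- cst m)%R \in Lfun mu 2%:E.
  rewrite inE; apply/andP; split; rewrite inE/=; first exact: measurable_funB.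
  rewrite /finite_norm unlock/=; apply: poweR_lty.
  apply: le_lt_trans VX; rewrite /variance !unlock.
  rewrite le_eqVlt; apply/orP; left; apply/eqP; apply: eq_integral => x _ /=.
  by rewrite powR_mulrn ?normr_ge0// real_normK ?num_real// expr2 /m !unlock.
have -> : (X : T -> R) = ((X \- cst m) \+ cst m)%R.
  by apply/funext => x /=; rewrite subrK.
by rewrite rpredD ?lee1n//= Lfun_cst.
Qed.

(** Independence says that the law of the pair agrees with the product of the two laws on
    rectangles; uniqueness of the product measure extends this to all measurable sets, and Fubini
    applies. *)
Lemma integral_independent_pair d1 d2 (T1 : measurableType d1) (T2 : measurableType d2)
    (X : {RV mu >-> T1}) (Y : {RV mu >-> T2}) (f : T1 * T2 -> \bar R) :
  (forall A B, measurable A -> measurable B ->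
    mu (X @^-1` A `&` Y @^-1` B) = mu (X @^-1` A) * mu (Y @^-1` B)) ->
  measurable_fun setT f -> mu.-integrable setT (fun w => f (X w, Y w)) ->
  \int[mu]_w f (X w, Y w) =
  \int[distribution mu X]_x \int[distribution mu Y]_y f (x, y).
Proof.
move=> XY mf fi; pose Z w := (X w, Y w).
have mZ : measurable_fun setT Z by exact/measurable_fun_pairP.
pose Zm : {mfun T >-> (T1 * T2)%type} :=
  HB.pack Z (isMeasurableFun.Build _ _ _ _ Z mZ).
have Zprod A : measurable A ->
    (distribution mu X \x distribution mu Y) A = distribution mu Zm A.
  by apply: product_measure_unique => A1 A2 mA1 mA2; rewrite -XY.
(* Fubini asks for integrability under the product of the laws; it is carried over from the law of
   the pair. *)
have intf : (distribution mu X \x distribution mu Y).-integrable setT f.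
  have : (distribution mu Zm).-integrable setT f.
    by apply: integrable_pushforward.
  move=> /integrableP[_ h]; apply/integrableP; split=> //.
  rewrite (eq_measure_integral (distribution mu Zm))// => A mA _.
  exact: Zprod.
rewrite (integral12_prod_meas1 intf).
rewrite (eq_measure_integral (distribution mu Zm)); last first.
  by move=> A mA _; exact: Zprod.
by rewrite integral_pushforward.
Qed.

(** The case f(x, y) = xy of the iterated integral; square integrability makes the product
    integrable. *)
Lemma expectation_mul_independent (X Y : {RV mu >-> R}) :
  (X : T -> R) \in Lfun mu 2%:E -> (Y : T -> R) \in Lfun mu 2%:E ->
  (forall A B : set R, measurable A -> measurable B ->
    mu (X @^-1` A `&` Y @^-1` B) = mu (X @^-1` A) * mu (Y @^-1` B)) ->
  'E_mu[(X : T -> R) * Y] = 'E_mu[X] * 'E_mu[Y].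
Proof.
move=> X2 Y2 XY.
have Pfin : mu setT \is a fin_num := fin_num_measure mu _ measurableT.
have /Lfun1_integrable X1 := Lfun_subset12 Pfin X2.
have /Lfun1_integrable Y1 := Lfun_subset12 Pfin Y2.
have /Lfun1_integrable XY1 := Lfun2_mul_Lfun1 X2 Y2.
rewrite [in LHS]unlock.
rewrite (integral_independent_pair (f := fun z : R * R => (z.1 * z.2)%:E) XY)//; last first.
  by apply/measurable_EFinP; exact: measurable_funM.
have EX : 'E_mu[X] = \int[distribution mu X]_x x%:E.
  by rewrite expectation_def integral_distribution.
have EY : 'E_mu[Y] = \int[distribution mu Y]_x x%:E.
  by rewrite expectation_def integral_distribution.
have iX : (distribution mu X).-integrable setT EFin by exact: integrable_pushforward.
have iY : (distribution mu Y).-integrable setT EFin by exact: integrable_pushforward.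
under eq_integral => x _.
  under eq_integral do rewrite EFinM.
  rewrite integralZl// -EY.
  over.
(* The mean of [Y] is finite, so it can leave the outer integral as a real factor. *)
have /fineK <- := expectation_fin_num (Lfun_subset12 Pfin Y2).
by rewrite integralZr// -EX.
Qed.

Lemma covariance_independent (X Y : {RV mu >-> R}) :
  (X : T -> R) \in Lfun mu 2%:E -> (Y : T -> R) \in Lfun mu 2%:E ->
  (forall A B : set R, measurable A -> measurable B ->
    mu (X @^-1` A `&` Y @^-1` B) = mu (X @^-1` A) * mu (Y @^-1` B)) ->
  covariance mu X Y = 0.
Proof.
move=> X2 Y2 XY.
have Pfin : mu setT \is a fin_num := fin_num_measure mu _ measurableT.
rewrite covarianceE ?Lfun2_mul_Lfun1 ?Lfun_subset12//.
rewrite expectation_mul_independent// subee//.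
by rewrite fin_numM// expectation_fin_num// Lfun_subset12.
Qed.

Lemma Lfun2_sum (I : eqType) (s : seq I) (X : I -> T -> R) :
  {in s, forall i, X i \in Lfun mu 2%:E} ->
  (fun w => \sum_(i <- s) X i w)%R \in Lfun mu 2%:E.
Proof.
move=> X2.
have -> : (fun w => \sum_(i <- s) X i w)%R = (\sum_(i <- s) X i)%R.
  by apply/funext => w; rewrite fct_sumE.
by rewrite big_seq rpred_sum ?lee1n.
Qed.

Lemma expectation_sum_seq (I : eqType) (s : seq I) (X : I -> T -> R) :
  {in s, forall i, X i \in Lfun mu 1} ->
  'E_mu[fun w => (\sum_(i <- s) X i w)%R] = \sum_(i <- s) 'E_mu[X i].
Proof.
move=> X1.
have -> : (fun w => \sum_(i <- s) X i w)%R = (\sum_(f <- map X s) f)%R.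
  by apply/funext => w; rewrite big_map fct_sumE.
by rewrite expectation_sum ?big_map// => f /mapP[i si ->]; exact: X1.
Qed.

Lemma covariance_sumr (I : eqType) (s : seq I) (X : I -> T -> R) (Y : T -> R) :
  Y \in Lfun mu 2%:E -> {in s, forall i, X i \in Lfun mu 2%:E} ->
  covariance mu Y (fun w => \sum_(i <- s) X i w)%R =
  \sum_(i <- s) covariance mu Y (X i).
Proof.
move=> Y2; elim: s => [|i s IH] X2.
  rewrite big_nil [X in covariance mu Y X](_ : _ = cst 0%R) ?covariance_cst_r//.
  by apply/funext => w; rewrite big_nil.
have Xs2 : {in s, forall i, X i \in Lfun mu 2%:E}.
  by move=> j sj; rewrite X2// inE sj orbT.
rewrite big_cons -IH// -covarianceDr//; last 2 first.
- by rewrite X2// mem_head.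
- exact: Lfun2_sum.
by congr (covariance mu Y _); apply/funext => w; rewrite big_cons.
Qed.

(** By induction: splitting off the head leaves its covariance with the tail sum, which expands into
    vanishing pairwise covariances. *)
Lemma variance_sum (I : eqType) (s : seq I) (X : I -> T -> R) :
  uniq s -> {in s, forall i, X i \in Lfun mu 2%:E} ->
  {in s &, forall i j, i != j -> covariance mu (X i) (X j) = 0} ->
  'V_mu[fun w => (\sum_(i <- s) X i w)%R] = \sum_(i <- s) 'V_mu[X i].
Proof.
elim: s => [|i s IH] /= us X2 X0.
  rewrite big_nil [X in variance mu X](_ : _ = cst 0%R) ?variance_cst//.
  by apply/funext => w; rewrite big_nil.
case/andP: us => nis us.
have Xi2 : X i \in Lfun mu 2%:E by rewrite X2// mem_head.
have Xs2 : {in s, forall i, X i \in Lfun mu 2%:E}.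
  by move=> j sj; rewrite X2// inE sj orbT.
rewrite big_cons -IH//; last first.
  by move=> j k sj sk; apply: X0; rewrite inE (sj, sk) orbT.
have -> : (fun w => \sum_(j <- i :: s) X j w)%R =
    (X i \+ (fun w => \sum_(j <- s) X j w))%R.
  by apply/funext => w; rewrite big_cons.
rewrite varianceD ?Lfun2_sum// covariance_sumr// big_seq big1 ?mule0 ?adde0//.
move=> j sj; rewrite X0 ?mem_head//; first by rewrite inE sj orbT.
by apply: contraNneq nis => ->.
Qed.

(** Variance is invariant under the shift by [c], and the second moment of the shifted variable is
    its variance plus its squared mean. *)
Lemma mean_square_error (X : T -> R) (c : R) : X \in Lfun mu 2%:E ->
  'E_mu[fun w => ((X w - c) ^+ 2)%R] =
  'V_mu[X] + ((fine 'E_mu[X] - c) ^+ 2)%:E.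
Proof.
move=> X2.
have Pfin : mu setT \is a fin_num := fin_num_measure mu _ measurableT.
have X1 := Lfun_subset12 Pfin X2.
have Xc2 : (X \- cst c)%R \in Lfun mu 2%:E.
  by rewrite rpredB ?lee1n//= Lfun_cst.
rewrite -(varianceB_cst_r c X2) varianceE//.
rewrite expectationB ?Lfun_cst// expectation_cst.
rewrite -{1}(fineK (expectation_fin_num X1)) -EFinB -EFin_expe subeK//.
Qed.

End second_moments.

(** * From mutual independence to additivity of variances *)

Section independence.
Local Open Scope ereal_scope.
Set Implicit Arguments.
Unset Strict Implicit.
Context d (T : measurableType d) (R : realType) (mu : probability T R).

Lemma mutually_independent2 (I : choiceType) (X : I -> {RV mu >-> R}) (i j : I)
    (A B : set R) :
  mutually_independent X -> i != j -> measurable A -> measurable B ->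
  mu (X i @^-1` A `&` X j @^-1` B) = mu (X i @^-1` A) * mu (X j @^-1` B).
Proof.
move=> Xind ij mA mB.
have jNi : (j == i) = false by rewrite eq_sym (negbTE ij).
(* The sets must be indexed by all of [I]; since [j] differs from [i], the default value [B] is the
   one attached to [j]. *)
have := Xind [fset i; j]%fset (fun k => if k == i then A else B).
rewrite big_fsetU1 ?inE// big_seq_fset1 eqxx jNi => <-; last first.
  by move=> k _; case: ifP.
congr (mu _); apply/seteqP; split => [w [Aw Bw] k|w H].
  by rewrite /= !inE => /orP[|] /eqP ->; rewrite ?eqxx ?jNi.
split; [have := H i|have := H j]; rewrite /= !inE eqxx ?orbT ?jNi.
  by move=> /(_ isT).
by move=> /(_ isT).
Qed.

Lemma variance_mutually_independent (I : finType) (X : I -> {RV mu >-> R}) :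
  mutually_independent X -> (forall i, (X i : T -> R) \in Lfun mu 2%:E) ->
  'V_mu[fun w => (\sum_i X i w)%R] = \sum_i 'V_mu[X i].
Proof.
move=> Xind X2; apply: variance_sum => [|//|i j _ _ ij].
  exact: index_enum_uniq.
by apply: covariance_independent => // A B; exact: mutually_independent2.
Qed.

End independence.

(** * Bias and mean-square error of the multilevel estimator *)

Section multilevel.
Local Open Scope ereal_scope.
Set Implicit Arguments.
Unset Strict Implicit.
Context d (T : measurableType d) (R : realType) (mu : probability T R).
Variables (P : {RV mu >-> R}) (Phat : nat -> {RV mu >-> R}).
Variables (Y : nat -> nat -> {RV mu >-> R}).
Hypothesis P1 : (P : T -> R) \in Lfun mu 1.
Hypothesis Phat1 : forall l, (Phat l : T -> R) \in Lfun mu 1.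
Hypothesis mean0 : forall n, (0 < n)%N -> 'E_mu[Y 0%N n] = 'E_mu[Phat 0%N].
Hypothesis meanS : forall l n : nat, (0 < l)%N -> (0 < n)%N ->
  'E_mu[Y l n] = 'E_mu[Phat l \- Phat l.-1].

Lemma multilevel_mean (L : nat) (N : nat -> nat) :
  (forall l, (l <= L)%N -> (0 < N l)%N) ->
  (forall l, (l <= L)%N -> (Y l (N l) : T -> R) \in Lfun mu 1) ->
  'E_mu[multilevel_estimator Y L N] = 'E_mu[Phat L].
Proof.
move=> N0 Y1.
rewrite expectation_sum_seq => [|i _]; last by rewrite Y1// -ltnS ltn_ord.
rewrite -(big_mkord xpredT (fun l => 'E_mu[Y l (N l)])).
have {Y1}: (L <= L)%N by [].
(* Telescoping by induction on the last summed level, while the bound [L] in the hypotheses stays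
   fixed. *)
elim: {1 3 4}L => [|l IH] lL.
  by rewrite big_nat1 mean0// N0.
rewrite big_nat_recr//= IH ?(ltnW lL)// meanS// ?N0// expectationB//.
by rewrite [LHS]addeC subeK// expectation_fin_num.
Qed.

Lemma multilevel_mse_bound (L : nat) (N : nat -> nat) (v : nat -> R) (b : R) :
  (forall l, (l <= L)%N -> (0 < N l)%N) ->
  mutually_independent (fun l : 'I_L.+1 => Y l (N l)) ->
  (forall l, (l <= L)%N -> 'V_mu[Y l (N l)] <= (v l)%:E) ->
  `| 'E_mu[Phat L \- P] | <= b%:E ->
  'E_mu[fun w => ((multilevel_estimator Y L N w - fine 'E_mu[P]) ^+ 2)%R]
    <= (\sum_(l < L.+1) v l + b ^+ 2)%:E.
Proof.
move=> N0 Yind Vv Eb.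
have Pfin : mu setT \is a fin_num := fin_num_measure mu _ measurableT.
(* A variance below a real number is finite, so every level estimator is square integrable. *)
have Y2 l : (l <= L)%N -> (Y l (N l) : T -> R) \in Lfun mu 2%:E.
  by move=> lL; apply: Lfun2_variance_lty; rewrite (le_lt_trans (Vv l lL))// ltry.
rewrite mean_square_error; last first.
  by apply: Lfun2_sum => i _; rewrite Y2// -ltnS ltn_ord.
rewrite EFinD leeD//.
  rewrite variance_mutually_independent// => [|i]; last first.
    by rewrite Y2// -ltnS ltn_ord.
  by rewrite -sumEFin lee_sum// => i _; rewrite Vv// -ltnS ltn_ord.
rewrite multilevel_mean//; last by move=> l lL; rewrite Lfun_subset12 ?Y2.
move: Eb; rewrite expectationB//.
(* Both means are finite, so the bias bound becomes an inequality between reals and can be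
   squared. *)
rewrite -(fineK (expectation_fin_num (Phat1 L))) -(fineK (expectation_fin_num P1)).
rewrite -EFinB abse_EFin !lee_fin => Eb.
by rewrite -(real_normK (num_real _)) lerXn2r ?nnegrE// (le_trans _ Eb).
Qed.

End multilevel.

(** * Geometric sums and the choice of the finest level and the sample sizes *)

Section allocation.
Set Implicit Arguments.
Unset Strict Implicit.
Context (R : realType).
Implicit Types (a b q x y : R).

Lemma powR_mul_nat a x n : 0 <= a -> a `^ (x * n%:R) = (a `^ x) ^+ n.
Proof. by move=> a0; rewrite powRrM powR_mulrn// powR_ge0. Qed.

Lemma powR_gt1 a x : 1 < a -> 0 < x -> 1 < a `^ x.
Proof.
move=> a1 x0; have a0 : 0 < a by lra.
by rewrite -(powRr0 a) /powR !gt_eqF// ltr_expR mul0r mulr_gt0// ln_gt0.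
Qed.

Lemma powR_lt1 a x : 1 < a -> x < 0 -> a `^ x < 1.
Proof.
move=> a1 x0; have a0 : 0 < a by lra.
by rewrite -[x]opprK powRN invf_lt1 ?powR_gt1 ?powR_gt0// oppr_gt0.
Qed.

Lemma geometric_sum_ge1 q n : 0 <= q -> 1 <= \sum_(i < n.+1) q ^+ i.
Proof.
move=> q0; rewrite big_ord_recl/= expr0 lerDl.
by rewrite sumr_ge0// => i _; rewrite exprn_ge0.
Qed.

Lemma geometric_sum_le_lt1 q n : 0 <= q -> q < 1 ->
  \sum_(i < n) q ^+ i <= (1 - q)^-1.
Proof.
move=> q0 q1; rewrite -[leRHS]mul1r ler_pdivlMr ?subr_gt0//.
have := subrX1 q n; have : 0 <= q ^+ n by exact: exprn_ge0.
by move=> ? ?; lra.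
Qed.

Lemma geometric_sum_le_gt1 q n : 1 < q ->
  \sum_(i < n.+1) q ^+ i <= q / (q - 1) * q ^+ n.
Proof.
move=> q1; rewrite mulrAC ler_pdivlMr ?subr_gt0// -exprS.
by have := subrX1 q n.+1 => ?; lra.
Qed.

Lemma ex_minimal_level alpha x : 0 < alpha -> 0 < x ->
  exists L : nat, x <= 2 `^ (alpha * L%:R) <= 2 `^ alpha * x + 1.
Proof.
move=> a0 x0; pose Q n := x <= 2 `^ (alpha * n%:R).
have ln2 : 0 < ln 2 :> R by rewrite ln_gt0// ltr1n.
have Qex : exists n, Q n.
  (* This [y] solves 2^(alpha y) = x, so any integer above it will do. *)
  pose y := ln x / (alpha * ln 2).
  exists (Num.truncn y).+1; rewrite /Q -[leLHS]lnK// /powR pnatr_eq0/= ler_expR.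
  have : y <= (Num.truncn y).+1%:R by exact/ltW/truncnS_gt.
  by rewrite ler_pdivrMr ?mulr_gt0// => h; rewrite mulrAC mulrC.
have [n Qn nmin] := ex_minnP Qex.
exists n; rewrite -/(Q n) Qn/=; case: n Qn nmin => [_ _|n _ nmin].
  by rewrite mulr0 powRr0 lerDr mulr_ge0 ?powR_ge0 ?ltW.
have /negP : ~ Q n by move/nmin; rewrite ltnn.
rewrite -ltNge => Qn.
rewrite -[n.+1%:R]natr1 mulrDr mulr1 addrC powRD ?pnatr_eq0 ?implybT//.
by rewrite ler_wpDr// ler_wpM2l ?powR_ge0// ltW.
Qed.

(* The optimal (Lagrange multiplier) sample sizes are proportional to the square
   root of variance over cost, i.e. to [u ^+ l]; [q ^+ l] is then, up to a
   constant, both the level variance and the level cost. *)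
Lemma sample_allocation (q u c eps : R) (L : nat) :
  0 < q -> 0 < u -> 0 < c -> 0 < eps ->
  let S := \sum_(l < L.+1) q ^+ l in
  exists N : nat -> nat,
    [/\ forall l, (0 < N l)%N,
        \sum_(l < L.+1) c * (N l)%:R^-1 * (u * q) ^+ l <= eps ^+ 2 / 2 &
        forall l, (N l)%:R <= 2 * c * eps ^- 2 * S * u ^+ l + 1].
Proof.
move=> q0 u0 c0 e0 S; pose m l := 2 * c * eps ^- 2 * S * u ^+ l.
have S0 : 0 < S := lt_le_trans ltr01 (geometric_sum_ge1 L (ltW q0)).
have m0 l : 0 < m l by rewrite !mulr_gt0 ?invr_gt0 ?exprn_gt0.
(* The successor of the truncation is positive, exceeds [m l], and does so by at most 1. *)
exists (fun l => (Num.truncn (m l)).+1); split => // [|l]; last first.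
  by rewrite -natr1 lerD2r truncn_le// ltW.
(* The scale of [m] is such that, before rounding, level [l] receives the share q^l / S of the
   variance budget. *)
have -> : eps ^+ 2 / 2 = \sum_(l < L.+1) eps ^+ 2 / (2 * S) * q ^+ l.
  by rewrite -mulr_sumr -/S invfM mulrA mulfVK ?gt_eqF.
apply: ler_sum => l _.
have -> : eps ^+ 2 / (2 * S) * q ^+ l = c * (m l)^-1 * (u * q) ^+ l.
  rewrite /m exprMn; field.
  by rewrite !gt_eqF ?exprn_gt0.
apply: ler_wpM2r; first by rewrite exprn_ge0// mulr_ge0 ?ltW.
apply: ler_wpM2l; first exact: ltW.
by rewrite lef_pV2 ?posrE ?ltr0n// ltW// truncnS_gt.
Qed.

(** Serves all regimes at once: [S L] stays unevaluated, and the bound by [K / eps] is what later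
    controls its growth in [L]. *)
Lemma multilevel_parameters (alpha beta gamma c1 c2 c3 : R) :
  0 < alpha -> 0 < gamma -> 0 < c1 -> 0 < c2 -> 0 < c3 ->
  2^-1 * gamma <= alpha ->
  let S L := \sum_(l < L.+1) (2 `^ ((gamma - beta) / 2)) ^+ l in
  exists A K : R, [/\ 0 < A, 1 <= K & forall eps : R, 0 < eps -> eps < 1 ->
    exists (L : nat) (N : nat -> nat),
      [/\ forall l, (0 < N l)%N,
          c1 * 2 `^ (- (alpha * L%:R)) <= eps / 2,
          2 `^ (alpha * L%:R) <= K / eps,
          \sum_(l < L.+1) c2 * (N l)%:R^-1 * 2 `^ (- (beta * l%:R))
            <= eps ^+ 2 / 2 &
          \sum_(l < L.+1) c3 * (N l)%:R * 2 `^ (gamma * l%:R)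
            <= A * eps ^- 2 * S L ^+ 2]].
Proof.
move=> alpha0 gamma0 c10 c20 c30 alpha_ge S.
(* Per level, variance decays by 2^(-beta) and cost grows by 2^gamma: [q] is the square root of the
   product of these factors, [u] that of their quotient. *)
pose q : R := 2 `^ ((gamma - beta) / 2); pose u : R := 2 `^ (- (beta + gamma) / 2).
pose g : R := 2 `^ gamma; pose K : R := 2 `^ alpha * (2 * c1) + 1.
have q0 : 0 < q by rewrite powR_gt0.
have u0 : 0 < u by rewrite powR_gt0.
have g1 : 1 < g by rewrite powR_gt1// ltr1n.
have uq : u * q = 2 `^ (- beta).
  by rewrite /u /q /g -powRD ?pnatr_eq0 ?implybT//; congr (2 `^ _); field.
have ug : u * g = q.
  by rewrite /u /q /g -powRD ?pnatr_eq0 ?implybT//; congr (2 `^ _); field.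
have K1 : 1 <= K by rewrite lerDr !mulr_ge0 ?powR_ge0 ?ltW.
have G0 : 0 < g / (g - 1) by rewrite divr_gt0 ?subr_gt0// (lt_trans ltr01).
(* In the first constant, [2 * c2] pays for the unrounded sample sizes and the other summand for the
   extra sample per level due to rounding. *)
exists (c3 * (2 * c2 + g / (g - 1) * K ^+ 2)), K; split => //.
  apply: mulr_gt0 => //; apply: addr_gt0; first exact: mulr_gt0.
  by rewrite mulr_gt0// exprn_gt0// (lt_le_trans ltr01).
move=> eps eps0 eps1.
(* Reaching this threshold is equivalent to a bias bound of at most [eps / 2]. *)
have x0 : 0 < 2 * c1 / eps by rewrite divr_gt0 ?mulr_gt0.
have [L /andP[L1 L2]] := ex_minimal_level alpha0 x0.
have [N [N0 NV NC]] := sample_allocation L q0 u0 c20 eps0.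
have LK : 2 `^ (alpha * L%:R) <= K / eps.
  apply: le_trans L2 _; rewrite [leRHS]mulrDl div1r.
  apply: lerD; first by rewrite !mulrA.
  by rewrite -[leLHS]invr1 lef_pV2 ?posrE// ltW.
have S1 : 1 <= S L by exact/geometric_sum_ge1/ltW.
(* Here [alpha_ge] enters: 2^(gamma L) is at most the square of 2^(alpha L). *)
have gL : g ^+ L <= K ^+ 2 * eps ^- 2.
  rewrite /g -powR_mul_nat ?ler0n// -exprVn -exprMn.
  apply: le_trans (lerXn2r 2 _ _ LK); rewrite ?nnegrE ?powR_ge0//; last first.
    by rewrite divr_ge0 ?ltW// (lt_le_trans ltr01).
  rewrite -powR_mulrn ?powR_ge0// -powRrM ler_powR ?ler1n//.
  by rewrite mulrAC ler_wpM2r ?ler0n//; lra.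
exists L, N; split => //.
- rewrite powRN ler_pdivrMr ?powR_gt0//.
  have : 2 * c1 <= 2 `^ (alpha * L%:R) * eps by rewrite -ler_pdivrMr.
  by move=> ?; lra.
- apply: le_trans NV; apply: ler_sum => l _.
  by rewrite uq -mulNr powR_mul_nat.
apply: (@le_trans _ _
    (c3 * (2 * c2 * eps ^- 2 * S L ^+ 2 + \sum_(l < L.+1) g ^+ l))).
  set B := 2 * c2 * eps ^- 2.
  have -> : B * S L ^+ 2 = \sum_(l < L.+1) B * S L * q ^+ l.
    by rewrite -mulr_sumr -/(S L) expr2 mulrA.
  rewrite -big_split mulr_sumr/=; apply: ler_sum => l _.
  rewrite -mulrA; apply: ler_wpM2l; first exact: ltW.
  rewrite powR_mul_nat// -/g -ug exprMn mulrA -[X in _ + X]mul1r -mulrDl.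
  by apply: ler_wpM2r; [rewrite exprn_ge0 ?powR_ge0|exact: NC].
rewrite -2!(mulrA c3); apply: ler_wpM2l; first exact: ltW.
set D := g / (g - 1); set e := eps ^- 2.
have -> : (2 * c2 + D * K ^+ 2) * e * S L ^+ 2 =
    2 * c2 * e * S L ^+ 2 + D * (K ^+ 2 * e * S L ^+ 2) by ring.
rewrite lerD2l.
apply: le_trans (geometric_sum_le_gt1 _ g1) _.
apply: ler_wpM2l; first exact: ltW.
apply: le_trans gL _.
(* As [S L] is at least 1, the rounding cost is absorbed into the factor [S L ^+ 2]. *)
rewrite ler_peMr ?exprn_ege1// mulr_ge0 ?invr_ge0 ?exprn_ge0 ?ltW//.
exact: lt_le_trans ltr01 K1.
Qed.

Lemma sum_sqr_le_lt1 q n : 0 <= q -> q < 1 ->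
  (\sum_(l < n) q ^+ l) ^+ 2 <= (1 - q)^-1 ^+ 2.
Proof.
move=> q0 q1; rewrite lerXn2r ?geometric_sum_le_lt1// nnegrE.
  by rewrite sumr_ge0// => i _; rewrite exprn_ge0.
by rewrite invr_ge0 subr_ge0 ltW.
Qed.

(** Taking logarithms bounds [L] by a multiple of ln K - ln eps; since [eps] is below 1/e, - ln eps
    is at least 1 and absorbs both ln K and the extra level. *)
Lemma level_count_le_ln (alpha K eps : R) (L : nat) :
  0 < alpha -> 1 <= K -> 0 < eps -> eps < expR (- 1) ->
  2 `^ (alpha * L%:R) <= K / eps ->
  L.+1%:R <= ((ln K + 1) / (alpha * ln 2) + 1) * - ln eps.
Proof.
move=> alpha0 K1 eps0 eps1 LK.
have K0 := lt_le_trans ltr01 K1.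
have ln2 : 0 < ln 2 :> R by rewrite ln_gt0// ltr1n.
have lneps : 1 <= - ln eps.
  by rewrite lerNr -[leRHS]expRK ler_ln ?posrE ?expR_gt0// ltW.
have lnK : 0 <= ln K by exact: ln_ge0.
have := LK; rewrite -ler_ln ?posrE ?powR_gt0 ?divr_gt0// ln_powR ln_div//.
rewrite mulrAC => h.
have aln2 : 0 < alpha * ln 2 by rewrite mulr_gt0.
rewrite mulrDl mul1r -[L.+1%:R]natr1 lerD// mulrAC ler_pdivlMr// mulrC.
by apply: le_trans h _; nra.
Qed.

(** The last term dominates the sum, and its square 2^(delta L) is the power delta/alpha of 2^(alpha
    L), hence controlled by [K / eps]. *)
Lemma sum_sqr_le_gt1 (alpha delta K eps : R) (L : nat) :
  0 < alpha -> 0 < delta -> 1 <= K -> 0 < eps ->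
  2 `^ (alpha * L%:R) <= K / eps ->
  (\sum_(l < L.+1) (2 `^ (delta / 2)) ^+ l) ^+ 2 <=
    (2 `^ (delta / 2) / (2 `^ (delta / 2) - 1)) ^+ 2 *
      K `^ (delta / alpha) * eps `^ (- (delta / alpha)).
Proof.
set q := 2 `^ (delta / 2); move=> alpha0 delta0 K1 eps0 LK.
have K0 := lt_le_trans ltr01 K1.
have q1 : 1 < q by rewrite powR_gt1 ?ltr1n// divr_gt0.
have Q0 : 0 <= q / (q - 1) by rewrite divr_ge0 ?powR_ge0// subr_ge0 ltW.
apply: (@le_trans _ _ ((q / (q - 1) * q ^+ L) ^+ 2)).
  rewrite lerXn2r ?geometric_sum_le_gt1// nnegrE; last first.
    by rewrite mulr_ge0// exprn_ge0 ?powR_ge0.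
  by rewrite sumr_ge0// => i _; rewrite exprn_ge0 ?powR_ge0.
rewrite exprMn -mulrA ler_wpM2l ?exprn_ge0//.
have -> : (q ^+ L) ^+ 2 = (2 `^ (alpha * L%:R)) `^ (delta / alpha).
  rewrite -exprM -powR_mulrn ?powR_ge0// -!powRrM natrM; congr (2 `^ _).
  by field; rewrite gt_eqF.
rewrite -[- (_ / _)]mulN1r [eps `^ _]powRrM powR_inv1 ?(ltW eps0)//.
rewrite -powRM ?invr_ge0 ?(ltW K0) ?(ltW eps0)//.
apply: ge0_ler_powR; rewrite ?nnegrE ?powR_ge0//.
- by rewrite divr_ge0 ?ltW.
- by rewrite divr_ge0 ?ltW.
Qed.

End allocation.

Theorem theorem3p1
  (R : realType) (d : measure_display) (Omega : measurableType d)
  (mu : probability Omega R)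
  (P : {RV mu >-> R}) (Phat : nat -> {RV mu >-> R})
  (P_integrable : mu.-integrable [set: Omega] (EFin \o P))
  (Phat_integrable : forall l : nat,
     mu.-integrable [set: Omega] (EFin \o Phat l))
  (Y : nat -> nat -> {RV mu >-> R})
  (C : nat -> nat -> R)
  (Y_independent : forall (L : nat) (N : nat -> nat),
     (forall l : nat, (l <= L)%N -> (0 < N l)%N) ->
     mutually_independent (fun l : 'I_L.+1 => Y l (N l)))
  (alpha beta gamma c1 c2 c3 : R)
  (alpha_gt0 : 0 < alpha) (beta_gt0 : 0 < beta) (gamma_gt0 : 0 < gamma)
  (c1_gt0 : 0 < c1) (c2_gt0 : 0 < c2) (c3_gt0 : 0 < c3)
  (alpha_ge : 2^-1 * gamma <= alpha)
  (weak_error : forall l : nat,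
     (`| 'E_mu[Phat l \- P] | <= (c1 * 2 `^ (- (alpha * l%:R)))%:E)%E)
  (mean0 : forall n : nat, (0 < n)%N ->
     ('E_mu[Y 0%N n] = 'E_mu[Phat 0%N])%E)
  (meanS : forall l n : nat, (0 < l)%N -> (0 < n)%N ->
     ('E_mu[Y l n] = 'E_mu[Phat l \- Phat l.-1])%E)
  (variance_bound : forall l n : nat, (0 < n)%N ->
     ('V_mu[Y l n] <= (c2 * n%:R^-1 * 2 `^ (- (beta * l%:R)))%:E)%E)
  (cost_bound : forall l n : nat, (0 < n)%N ->
     C l n <= c3 * n%:R * 2 `^ (gamma * l%:R)) :
  exists c4 : R, 0 < c4 /\
    forall eps : R, 0 < eps -> eps < expR (- 1) ->
    exists (L : nat) (N : nat -> nat),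
      [/\ forall l : nat, (l <= L)%N -> (0 < N l)%N,
          ('E_mu[(fun w => (multilevel_estimator Y L N w - fine 'E_mu[P]) ^+ 2)%R]
             < (eps ^+ 2)%:E)%E &
          [/\ gamma < beta -> multilevel_complexity C L N <= c4 * eps ^- 2,
              beta = gamma ->
                multilevel_complexity C L N <= c4 * eps ^- 2 * (ln eps) ^+ 2 &
              beta < gamma ->
                multilevel_complexity C L N
                  <= c4 * eps `^ (- 2 - (gamma - beta) / alpha)]].
Proof.
have [A [K [A0 K1 param]]] :=
  multilevel_parameters beta alpha_gt0 gamma_gt0 c1_gt0 c2_gt0 c3_gt0 alpha_ge.
pose q : R := 2 `^ ((gamma - beta) / 2).
pose S L : R := \sum_(l < L.+1) q ^+ l.
(* Error and cost before any case distinction; the regimes differ only in how [S L] is estimated. *)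
have main eps : 0 < eps -> eps < expR (- 1) -> exists (L : nat) (N : nat -> nat),
  [/\ forall l : nat, (l <= L)%N -> (0 < N l)%N,
      ('E_mu[(fun w => (multilevel_estimator Y L N w - fine 'E_mu[P]) ^+ 2)%R]
         < (eps ^+ 2)%:E)%E,
      2 `^ (alpha * L%:R) <= K / eps &
      multilevel_complexity C L N <= A * eps ^- 2 * S L ^+ 2].
  move=> eps0 epse.
  have eps1 : eps < 1 by rewrite (lt_trans epse)// expR_lt1 ltrN10.
  have [L [N [N0 bias LK var cost]]] := param eps eps0 eps1.
  exists L, N; split => //; last first.
    by apply: le_trans cost; apply: ler_sum => l _; rewrite cost_bound.
  have biasN : 0 <= c1 * 2 `^ (- (alpha * L%:R)).
    by rewrite mulr_ge0 ?powR_ge0// ltW.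
  apply: le_lt_trans (multilevel_mse_bound _ _ mean0 meanS (fun l _ => N0 l) _
    (fun l _ => variance_bound l (N l) (N0 l)) (weak_error L)) _.
  - exact/Lfun1_integrable.
  - by move=> l; exact/Lfun1_integrable.
  - exact: Y_independent.
  (* Variance and squared bias add up to at most eps^2/2 + eps^2/4, which makes the inequality
     strict. *)
  - by rewrite lte_fin; nra.
(* [beta] and [gamma] are fixed before [c4], so each regime picks its own constant and the other two
   clauses hold vacuously. *)
have [gb|bg|gb] := ltgtP gamma beta.
- have q0 : 0 <= q := powR_ge0 _ _.
  have q1 : q < 1 by rewrite powR_lt1 ?ltr1n//; lra.
  exists (A * (1 - q)^-1 ^+ 2); split.
    by rewrite mulr_gt0// exprn_gt0// invr_gt0 subr_gt0.
  move=> eps eps0 epse; have [L [N [N0 mse LK cost]]] := main eps eps0 epse.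
  exists L, N; split => //; split => // [_|bg_eq]; [|lra].
  apply: le_trans cost _; rewrite [leRHS]mulrAC.
  apply: ler_wpM2l; last exact: sum_sqr_le_lt1.
  by rewrite mulr_ge0 ?invr_ge0 ?exprn_ge0// ltW.
- set delta := gamma - beta; have delta0 : 0 < delta by rewrite subr_gt0.
  have q1 : 1 < q by rewrite powR_gt1 ?ltr1n// divr_gt0.
  have K0 := lt_le_trans ltr01 K1.
  set D := (q / (q - 1)) ^+ 2 * K `^ (delta / alpha).
  exists (A * D); split.
    apply: mulr_gt0 => //; apply: mulr_gt0; last exact: powR_gt0.
    by rewrite exprn_gt0// divr_gt0 ?subr_gt0// powR_gt0.
  move=> eps eps0 epse; have [L [N [N0 mse LK cost]]] := main eps eps0 epse.
  exists L, N; split => //; split => // [bg_eq|_]; [lra|].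
  apply: le_trans cost _.
  rewrite powRD ?(gt_eqF eps0) ?implybT// powR_invn ?(ltW eps0)//.
  rewrite [leRHS]mulrACA.
  apply: ler_wpM2l; last exact: sum_sqr_le_gt1.
  by rewrite mulr_ge0 ?invr_ge0 ?exprn_ge0// ltW.
(* With ratio 1 the sum just counts the levels, whose number is logarithmic in [eps]. *)
- have q1 : q = 1 by rewrite /q gb subrr mul0r powRr0.
  set D := (ln K + 1) / (alpha * ln 2) + 1.
  have D0 : 0 < D.
    rewrite ltr_wpDl// divr_ge0 ?addr_ge0 ?ln_ge0//.
    by rewrite mulr_ge0 ?(ltW alpha_gt0)// ln_ge0// ler1n.
  exists (A * D ^+ 2); split; first by rewrite mulr_gt0// exprn_gt0.
  move=> eps eps0 epse; have [L [N [N0 mse LK cost]]] := main eps eps0 epse.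
  exists L, N; split => //; split => // _.
  apply: le_trans cost _.
  have SL : S L = L.+1%:R.
    rewrite /S q1; under eq_bigr do rewrite expr1n.
    by rewrite sumr_const card_ord.
  have -> : A * D ^+ 2 * eps ^- 2 * ln eps ^+ 2 =
      A * eps ^- 2 * (D * - ln eps) ^+ 2 by ring.
  apply: ler_wpM2l; first by rewrite mulr_ge0 ?invr_ge0 ?exprn_ge0// ltW.
  have := level_count_le_ln alpha_gt0 K1 eps0 epse LK; rewrite -SL => h.
  have S0 : 0 <= S L by rewrite SL ler0n.
  by rewrite lerXn2r ?nnegrE// (le_trans S0 h).
Qed.
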